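(* For all integers $0\le k\le r$ there is a constant $\tau$ depending only on $k$ such that whenever $b=\binom{c_{k-1}}{k-1}+\dots+\binom{c_1}{1}$ for some integers $c_{k-1}>c_{k-2}>\dots>c_1\ge 0$, we have \[\binom{c_{k-1}}{k}+\dots+\binom{c_1}{2}\;\le\; f(r,k,b)\;\le\;\binom{c_{k-1}}{k}+\dots+\binom{c_1}{2}+\tau.\]
   Context: $\mathbb{N}^{(s)}$ denotes the family of all $s$-element subsets of $\mathbb{N}$. For integers $0\le k\le r$ and $b\ge 0$, $f(r,k,b)$ denotes the maximum of $|\mathcal{A}|$ over all pairs of families $\mathcal{A}\subset\mathbb{N}^{(r)}$, $\mathcal{B}\subset\mathbb{N}^{(r-1)}$ with $|\mathcal{B}|=b$ such that for every $A\in\mathcal{A}$ there exist $k$ distinct sets $B_1,\dots,B_k\in\mathcal{B}$ with $B_i\subset A$ for all $i$. Binomial coefficients $\binom{c}{i}$ with $c<i$ are $0$.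
   Formalization: The formal theorem assumes k ≥ 1 instead of k ≥ 0: for k = 0 the sum is empty, so b = 0, and for r ≥ 1 every family of r-sets is admissible, so f(r,0,0) is infinite and the upper bound fails. *)

(* Defs.v *)
From HB Require Import structures.
From mathcomp Require Import all_boot all_order finmap.
Set Implicit Arguments. Unset Strict Implicit. Unset Printing Implicit Defensive.
Local Open Scope fset_scope.

Definition admissible (r k : nat) (A B : {fset {fset nat}}) : Prop :=
  (forall X, X \in A -> #|` X| = r) /\
  (forall Y, Y \in B -> #|` Y| = r.-1) /\
  (forall X, X \in A -> exists s : seq {fset nat},
      [/\ size s = k, uniq s & forall Y, Y \in s -> Y \in B /\ Y `<=` X]).

Definition f_atleast (r k b n : nat) : Prop :=
  exists A B : {fset {fset nat}}, [/\ admissible r k A B, #|` B| = b & n <= #|` A|].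

(* "f(r,k,b) <= n": every admissible pair with |B| = b has |A| <= n.
   (Quantifying over finite families suffices: an infinite admissible family
   has finite admissible subfamilies of every size.) *)
Definition f_atmost (r k b n : nat) : Prop :=
  forall A B : {fset {fset nat}}, admissible r k A B -> #|` B| = b -> #|` A| <= n.

(* Main.v *)
Require Import Defs.
From mathcomp Require Import all_boot all_order finmap.
From mathcomp Require Import zify.
Set Implicit Arguments. Unset Strict Implicit. Unset Printing Implicit Defensive.

(** Write [K b] for the Kruskal-Katona value [C(c_(k-1),k) + ... + C(c_1,2)].

    Splitting a pair (A, B) at an element x gives three kinds of X in A: those
    avoiding x, those whose k subsets can all be chosen through x, and those
    with X \ x in B.  Hence, if b_x members of B contain x,
      f(r,k,b) <= f(r-1,k,b_x) + f(r,k,b-b_x) + (b-b_x).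
    When r = k this is the Kruskal-Katona theorem.  When r > k there are three
    cases.  If every b_x is a small fraction of b, then |A| is below K b, since
    every X in A is of the second kind for at least r-k elements x, while
    f(r,k,s) = O(s^(k/(k-1))) by a minimum degree argument.  If some b_x is
    neither close to 0 nor close to b, then the strict convexity of K wins a
    constant factor.  Otherwise b - b_x is a small fraction of b for some x, and
    passing to the link of x loses s + O(s^(k/(k-1))), where s = b - b_x.
    The losses of successive passages add up superadditively, and are at most
    K b - K (b-s) + O(1) for the total s because adding s sets to a clique
    creates of order s^((k-1)/(k-2)) new ones. *)

(** * The cascade function *)

(** For [j > 0] this is the greatest c with C(c,j) <= n; the range suffices because C(n+j,j) > n. *)
Definition casc_top j n := find (fun c => n < 'C(c.+1, j)) (iota 0 (n + j).+1).

Lemma casc_topP j n : 'C(casc_top j.+1 n, j.+1) <= n < 'C((casc_top j.+1 n).+1, j.+1).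
Proof.
have hasP : has (fun c => n < 'C(c.+1, j.+1)) (iota 0 (n + j.+1).+1).
  apply/hasP; exists (n + j); first by rewrite mem_iota; lia.
  elim: j => [|j IHj]; first by rewrite addn0 bin1.
  by rewrite addnS binS; lia.
have lt_top := hasP; rewrite has_find size_iota in lt_top.
apply/andP; split; last first.
  have := nth_find 0 hasP.
  by rewrite nth_iota.
case E: (casc_top j.+1 n) => [|c]; first by rewrite bin0n.
have lt_c : c < casc_top j.+1 n by rewrite E.
have := before_find 0 lt_c.
rewrite nth_iota; last by apply: leq_trans lt_c _; apply: ltnW.
by rewrite add0n; lia.
Qed.

Lemma casc_top_eq j n c :
  'C(c, j.+1) <= n < 'C(c.+1, j.+1) -> casc_top j.+1 n = c.
Proof.
case/andP=> h1 h2; have /andP[h3 h4] := casc_topP j n.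
case: (ltngtP (casc_top j.+1 n) c) => // h.
- by have := leq_bin2l j.+1 h; lia.
- by have := leq_bin2l j.+1 h; lia.
Qed.

(* For j > 0 and c_j > ... > c_1 >= 0, casc j maps C(c_j,j) + ... + C(c_1,1) to
   C(c_j,j+1) + ... + C(c_1,2). *)
Fixpoint casc (j n : nat) : nat :=
  if j is i.+1 then 'C(casc_top j n, j.+1) + casc i (n - 'C(casc_top j n, j)) else 0.

Lemma casc_eq j n c : 'C(c, j.+1) <= n < 'C(c.+1, j.+1) ->
  casc j.+1 n = 'C(c, j.+2) + casc j (n - 'C(c, j.+1)).
Proof. by move=> /casc_top_eq E; rewrite /= E. Qed.

Lemma casc0 j : casc j 0 = 0.
Proof.
elim: j => // j IHj.
by rewrite (@casc_eq _ _ j) ?sub0n ?IHj ?binn ?bin_small.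
Qed.

Lemma casc_bin j c : 0 < j -> casc j 'C(c, j) = 'C(c, j.+1).
Proof.
case: j => // j _; have [h|h] := leqP j c.
  rewrite (@casc_eq _ _ c) ?subnn ?casc0 ?addn0 // leqnn binS.
  by have := bin_gt0 c j; lia.
by rewrite !bin_small ?casc0 //; lia.
Qed.

Lemma casc1 n : casc 1 n = 'C(n, 2).
Proof. by rewrite -[n in LHS]bin1 casc_bin. Qed.

(** At the closed end t = C(c,j) the argument is C(c+1,j+1), and Pascal's rule applies to both
    sides; so a full last block need not be renormalised. *)
Lemma casc_rec j c t : 0 < j -> t <= 'C(c, j) ->
  casc j.+1 ('C(c, j.+1) + t) = 'C(c, j.+2) + casc j t.
Proof.
move=> j0; rewrite leq_eqVlt => /predU1P[->|lt_t].
  by rewrite -binS !casc_bin // -binS.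
by rewrite (@casc_eq _ _ c) ?binS; [congr (_ + casc _ _)|]; lia.
Qed.

Lemma casc_split j n : exists c t, n = 'C(c, j.+1) + t /\ t < 'C(c, j).
Proof.
have := casc_topP j n; set c := casc_top _ _; rewrite binS => h.
by exists c, (n - 'C(c, j.+1)); lia.
Qed.

Lemma casc_split_pos j n : 0 < n ->
  exists c t, n = 'C(c, j.+1) + t /\ 0 < t <= 'C(c, j).
Proof.
move=> n0; have [c [t [h1 h2]]] := casc_split j n.-1.
by exists c, t.+1; lia.
Qed.

Lemma casc_mono j m n : m <= n -> casc j m <= casc j n.
Proof.
elim: j m n => // -[|j] IHj m n le_mn; first by rewrite !casc1 leq_bin2l.
have [c [s [Em hs]]] := casc_split j.+1 m.
have [d [t [En ht]]] := casc_split j.+1 n.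
rewrite Em En !casc_rec; try lia.
case: (ltngtP c d) => h.
- have := leq_bin2l j.+3 h; rewrite binS.
  have := IHj s 'C(c, j.+1) (ltnW hs); rewrite casc_bin //; lia.
- have := leq_bin2l j.+2 h; rewrite binS; lia.
- by subst d; rewrite leq_add2l IHj //; lia.
Qed.

(* The number of new (i+2)-sets obtained from n sets of size i+1 when a new vertex
   is joined to y sets of size i; for i = 0 a single new vertex (y > 0) is joined to
   all n singletons. *)
Definition link_cap i y n := if i is 0 then (0 < y) * n else minn (casc i y) n.

(* The numerical (Eckhoff-Wegner) form of the induction step of Kruskal-Katona. *)
Definition add_vertex i := forall n y, casc i.+1 n + link_cap i y n <= casc i.+1 (n + y).
Definition superadd i := forall a b, casc i a + casc i b <= casc i (a + b).
(** Rebalancing: with a + b fixed, filling one argument up to a full clique does not lower the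
    total. *)
Definition clique_exchange i := forall c a b, a <= 'C(c, i) -> b <= 'C(c, i) ->
  'C(c, i) <= a + b ->
  casc i a + casc i b <= 'C(c, i.+1) + casc i (a + b - 'C(c, i)).

Lemma add_vertex0 : add_vertex 0.
Proof.
move=> n [|y]; rewrite !casc1 /= ?addn0 // mul1n addnS binS bin1.
by have := leq_bin2l 2 (leq_addr y n); lia.
Qed.

Lemma bin2D a b : 'C(a + b, 2) = 'C(a, 2) + 'C(b, 2) + a * b.
Proof.
elim: b => [|b IHb]; first by rewrite addn0 muln0 bin0n !addn0.
by rewrite addnS !binS !bin1 IHb mulnS; lia.
Qed.

Lemma superadd1 : superadd 1.
Proof. by move=> a b; rewrite !casc1 bin2D leq_addr. Qed.

Lemma clique_exchange1 : clique_exchange 1.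
Proof.
move=> c a b; rewrite !casc1 !bin1 => ha hb hc.
have [u Eu] : exists u, c = a + u by exists (c - a); lia.
have [v Ev] : exists v, b = u + v by exists (b - u); lia.
have -> : a + b - c = v by lia.
rewrite Eu Ev !bin2D.
have h : v <= a by lia.
by have := leq_mul2r u v a; rewrite h orbT; lia.
Qed.

(* Move from b to a the last block y of the cascade of b, until b is used up. *)
Lemma superadd_step i : 0 < i -> add_vertex i -> superadd i.+1.
Proof.
move=> i0 ew.
suff H b a : b <= a -> casc i.+1 a + casc i.+1 b <= casc i.+1 (a + b).
  by move=> a b; case: (leqP b a) => [/H//|/ltnW/H]; rewrite addnC [b + a]addnC.
elim/ltn_ind: b a => b IH a le_ba.
have [->|b0] := posnP b; first by rewrite casc0 !addn0.
have [d [y [Eb /andP[y0 hy]]]] := casc_split_pos i b0.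
have := ew a y; rewrite /link_cap; case: i i0 IH ew Eb hy => // i _ IH ew Eb hy.
have hm := casc_mono i.+1 hy; rewrite casc_bin // in hm.
rewrite (minn_idPl _); last by lia.
have := IH (b - y) _ (a + y) _; rewrite -addnA subnKC; last by lia.
have -> : b - y = 'C(d, i.+2) by lia.
have -> : casc i.+2 b = 'C(d, i.+3) + casc i.+1 y by rewrite Eb casc_rec.
by rewrite casc_bin //; lia.
Qed.

(* Same transfer from b to a; if it overshoots C(c,i+1), then a and b are both cut
   inside their last block, and the case i applies to the two blocks. *)
Lemma clique_exchange_step i : 0 < i -> add_vertex i -> clique_exchange i -> clique_exchange i.+1.
Proof.
move=> i0 ew cl.
suff H c b a : b <= a -> a <= 'C(c, i.+1) -> 'C(c, i.+1) <= a + b ->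
    casc i.+1 a + casc i.+1 b <= 'C(c, i.+2) + casc i.+1 (a + b - 'C(c, i.+1)).
  move=> c a b ha hb hc; case: (leqP b a) => [h|/ltnW h]; first exact: H.
  by rewrite addnC [a + b]addnC H // addnC.
elim/ltn_ind: b a => b IH a le_ba.
rewrite leq_eqVlt => /predU1P[->|lt_a] hab.
  by rewrite casc_bin // addKn.
have b0 : 0 < b by lia.
have [d [y [Eb /andP[y0 hy]]]] := casc_split_pos i b0.
have ltdc : d < c.
  rewrite ltnNge; apply/negP => /(@leq_bin2l _ _ i.+1); lia.
case: c ltdc lt_a hab IH => // c ltdc lt_a hab IH.
have hy' : y <= 'C(c, i) by apply: leq_trans hy _; apply: leq_bin2l.
have [h|h] := leqP (a + y) 'C(c.+1, i.+1).
  have := ew a y; rewrite /link_cap; case: i i0 IH ew cl Eb hy hy' lt_a hab h => // i _ IH ew cl Eb hy hy' lt_a hab h.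
  have hm := casc_mono i.+1 hy; rewrite casc_bin // in hm.
  rewrite (minn_idPl _); last by lia.
  have := IH (b - y) _ (a + y) _ h _; rewrite -addnA subnKC; last by lia.
  have -> : b - y = 'C(d, i.+2) by lia.
  have -> : casc i.+2 b = 'C(d, i.+3) + casc i.+1 y by rewrite Eb casc_rec.
  by rewrite casc_bin //; lia.
move: lt_a h hab; rewrite !binS => lt_a h hab.
have Ea : a = 'C(c, i.+1) + (a - 'C(c, i.+1)) by lia.
have := cl c (a - 'C(c, i.+1)) y _ hy' _.
have -> : casc i.+1 a = 'C(c, i.+2) + casc i (a - 'C(c, i.+1)).
  by rewrite {1}Ea casc_rec //; lia.
have -> : casc i.+1 b = 'C(d, i.+2) + casc i y by rewrite Eb casc_rec.
have -> : a + b - ('C(c, i.+1) + 'C(c, i)) =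
  'C(d, i.+1) + (a - 'C(c, i.+1) + y - 'C(c, i)) by lia.
rewrite casc_rec //; last by lia.
by lia.
Qed.

(** Write n = C(c,i+2) + n'. If y <= C(c,i+1), the blocks n' and y either fit together
    (superadditivity) or overflow (exchange). Otherwise C(c,i+1) of the y sets complete the clique
    on c+1 vertices, and the induction hypothesis merges the rest with n'. *)
Lemma add_vertex_step i : add_vertex i -> superadd i.+1 -> clique_exchange i.+1 -> add_vertex i.+1.
Proof.
move=> ew sa cl n y.
have [c [n' [En hn]]] := casc_split i.+1 n.
rewrite /link_cap; have [hy|hy] := leqP y 'C(c, i.+1).
  have [h|h] := leqP (n' + y) 'C(c, i.+1).
    rewrite En -addnA !casc_rec //; last by lia.
    by have := sa n' y; lia.
  have -> : n + y = 'C(c.+1, i.+2) + (n' + y - 'C(c, i.+1)) by rewrite binS; lia.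
  have -> : casc i.+2 n = 'C(c, i.+3) + casc i.+1 n' by rewrite En casc_rec // ltnW.
  rewrite casc_rec ?binS //; try lia.
  by have := cl c n' y; lia.
(* Sets beyond C(c,i) more are dropped: by then the cap n is already attained. *)
pose y' := minn (y - 'C(c, i.+1)) 'C(c, i).
have /(casc_mono i.+2) : 'C(c.+1, i.+2) + (n' + y') <= n + y.
  by rewrite binS /y'; lia.
rewrite casc_rec //; last by rewrite binS /y'; lia.
have -> : casc i.+2 n = 'C(c, i.+3) + casc i.+1 n' by rewrite En casc_rec // ltnW.
have := ew n' y'; rewrite /link_cap (binS c i.+2).
case: i ew sa cl hn hy @y' En => [|i] ew sa cl hn hy y' En.
  have -> : 0 < y' by rewrite /y' bin0; lia.
  by lia.
have [h|h] := leqP (y - 'C(c, i.+2)) 'C(c, i.+1).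
  have -> : y' = y - 'C(c, i.+2) by rewrite /y'; lia.
  have -> : casc i.+2 y = 'C(c, i.+3) + casc i.+1 (y - 'C(c, i.+2)).
    by rewrite -casc_rec // subnKC //; lia.
  by lia.
have -> : y' = 'C(c, i.+1) by rewrite /y'; lia.
by rewrite casc_bin //; lia.
Qed.

Lemma casc_inequalities i : [/\ add_vertex i, superadd i.+1 & clique_exchange i.+1].
Proof.
elim: i => [|i [ew sa cl]]; first by split; [exact: add_vertex0|exact: superadd1|exact: clique_exchange1].
have ew' := add_vertex_step ew sa cl.
by split=> //; [exact: superadd_step|exact: clique_exchange_step].
Qed.

(** * Growth estimates *)

(** Add m new vertices in turn, each joined to all j-sets of a clique on c vertices; the cap in
    [link_cap] never acts because n >= C(c,j+1). *)
Lemma casc_grow j n c m : 0 < j -> 'C(c, j.+1) <= n ->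
  casc j.+1 n + m * 'C(c, j.+1) <= casc j.+1 (n + m * 'C(c, j)).
Proof.
case: j => // j _ le_n; have [ew _ _] := casc_inequalities j.+1.
elim: m => [|m IHm]; first by rewrite !mul0n !addn0.
rewrite !mulSn addnCA [in leqRHS]addnCA [in leqRHS]addnC.
apply: leq_trans (ew _ _).
rewrite /link_cap casc_bin // (minn_idPl _); first by rewrite addnC leq_add2r.
by apply: leq_trans le_n (leq_addr _ _).
Qed.

(* The least D with s * j! < C(D,j): a pair (A, B) with #|B| = s has fewer than D
   members of A above some member of B. *)
Definition crude_deg j s := (casc_top j (s * j`!)).+1.
Definition crude j s := s * crude_deg j s.

Lemma crude_degP j s : 0 < j -> s * j`! < 'C(crude_deg j s, j).
Proof. by case: j => // j _; have /andP[] := casc_topP j (s * (j.+1)`!). Qed.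

Lemma crude_deg_min j s D : 0 < j -> s * j`! < 'C(D, j) -> crude_deg j s <= D.
Proof.
case: j => // j _ lt_s; have /andP[h _] := casc_topP j (s * (j.+1)`!).
rewrite /crude_deg ltnNge; apply/negP => /(@leq_bin2l _ _ j.+1); lia.
Qed.

Lemma crude_deg_mono j s t : 0 < j -> s <= t -> crude_deg j s <= crude_deg j t.
Proof.
move=> j0 le_st; apply: crude_deg_min => //; apply: leq_ltn_trans (crude_degP t j0).
by rewrite leq_mul2r le_st orbT.
Qed.

Lemma crude_mono j s t : 0 < j -> s <= t -> crude j s <= crude j t.
Proof. by move=> j0 h; apply: leq_mul => //; apply: crude_deg_mono. Qed.

Lemma crude_add j s t : 0 < j -> crude j s + crude j t <= crude j (s + t).
Proof.
move=> j0; rewrite /crude mulnDl leq_add // leq_mul2l crude_deg_mono ?orbT //.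
- exact: leq_addr.
- exact: leq_addl.
Qed.

Lemma ffact_ub n m : n ^_ m <= n ^ m.
Proof. by elim: m => // m IHm; rewrite ffactnSr expnSr leq_mul // leq_subr. Qed.

Lemma ffact_lb n m p : m <= p -> (n - p) ^ m <= n ^_ m.
Proof.
elim: m => // m IHm lt_m; rewrite ffactnSr expnSr leq_mul // ?IHm; lia.
Qed.

(** As [crude_deg j s] is of order s^(1/j), making s a small fraction of C(c+1,j) pushes it below a
    prescribed fraction of c. *)
Lemma crude_deg_small j R : 0 < j -> 0 < R -> exists E c0, 0 < E /\
  forall c s, c0 <= c -> s * E <= 'C(c.+1, j) -> crude_deg j s <= c %/ R.
Proof.
move=> j0 R0; exists ((2 * R) ^ j * j`!).+1, (2 * R * j.+1).+1; split=> // c s hc hs.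
apply: crude_deg_min => //; set D := c %/ R.
have hD : c.+1 <= 2 * R * (D - j).
  have h1 : c < R * D.+1 by rewrite mulnC ltn_ceil.
  have h2 : 2 * R * j < R * D.
    by move: h1 hc; rewrite !mulnS; nia.
  rewrite mulnBr; move: h1 hc; rewrite !mulnS; lia.
have h1 : 'C(c.+1, j) * j`! <= (2 * R) ^ j * ('C(D, j) * j`!).
  rewrite !bin_ffact; apply: leq_trans (ffact_ub _ _) _.
  apply: leq_trans (_ : (2 * R * (D - j)) ^ j <= _); first by rewrite leq_exp2r.
  by rewrite expnMn leq_mul2l ffact_lb ?orbT.
have D0 : 0 < 'C(D, j) by rewrite bin_gt0; nia.
rewrite -(@ltn_pmul2r ((2 * R) ^ j * j`!).+1) //.
have h2 := leq_mul hs (leqnn j`!).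
rewrite mulnAC; apply: leq_ltn_trans h2 _; apply: leq_ltn_trans h1 _.
by rewrite mulnCA ltn_pmul2l.
Qed.

Lemma bin_double c j : 2 * j <= c -> 'C(c.+1, j) <= 2 * 'C(c, j).
Proof.
case: j => [|j] hj; first by rewrite !bin0.
have := mul_bin_left c j; rewrite binS; nia.
Qed.

(** The gain from s extra sets is of order s d / (j+1), for a clique size d limited by both s and n,
    while [crude] costs at most s d / R. A large R lets the gain win; small s is absorbed in
    [tau]. *)
Lemma removal_gain j R E c0 M : 0 < j -> 4 * j.+1 <= R -> 0 < E ->
  (forall c s, c0 <= c -> s * E <= 'C(c.+1, j.+1) -> crude_deg j.+1 s <= c %/ R) ->
  exists tau, forall n s, s * E.+1 <= n + s ->
    casc j.+1 n + M * s + crude j.+1 s <= casc j.+1 (n + s) + tau.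
Proof.
move=> j0 hR E0 hE; set J := j.+1 in hR hE *.
pose d0 := c0 + 4 * J * M + 2 * J + E * J + J.
pose s0 := 'C(d0, j) + 'C(d0, J).
exists (M * s0 + crude J s0) => n s hs.
have hmono : casc J n <= casc J (n + s) by rewrite casc_mono ?leq_addr.
have small : s <= s0 ->
    casc J n + M * s + crude J s <= casc J (n + s) + (M * s0 + crude J s0).
  move=> h; rewrite -addnA leq_add // leq_add ?leq_mul2l ?h ?orbT //.
  exact: crude_mono.
have large d m : d0 <= d -> 'C(d, J) <= n -> m * 'C(d, j) <= s ->
    s <= 2 * m * 'C(d, j) -> crude_deg J s <= d %/ R ->
    casc J n + M * s + crude J s <= casc J (n + s).
  move=> hd hn hms hsm hdeg.
  have h1 : casc J n + m * 'C(d, J) <= casc J (n + m * 'C(d, j)).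
    exact: casc_grow.
  have h2 : casc J (n + m * 'C(d, j)) <= casc J (n + s).
    by rewrite casc_mono // leq_add2l.
  suff : M * s + crude J s <= m * 'C(d, J) by lia.
  rewrite /crude mulnC -mulnDr.
  have h3 : J * 'C(d, J) = (d - j) * 'C(d, j) := mul_bin_left d j.
  have h4 : 2 * J * (M + d %/ R) <= d - j.
    have h4 : 4 * J * (d %/ R) <= d.
      by apply: leq_trans (leq_trunc_div d R); rewrite mulnC leq_mul2l hR orbT.
    have : j < J by [].
    by rewrite /d0 in hd; lia.
  rewrite -(@leq_pmul2l J) // [leqRHS]mulnCA h3.
  apply: leq_trans (_ : J * (2 * m * 'C(d, j) * (M + d %/ R)) <= _).
    by rewrite leq_mul2l leq_mul // leq_add2l.
  have := leq_mul h4 (leqnn (m * 'C(d, j))); lia.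
have /andP[he1 he2] : 'C(casc_top j s, j) <= s < 'C((casc_top j s).+1, j).
  by case: (j) j0 => // i _; exact: casc_topP.
have /andP[] := casc_topP j n; rewrite -/J; set c := casc_top J n => hc1 hc2.
set e := casc_top j s in he1 he2.
(* If e <= c, one new vertex joined to a clique on e vertices is enough. Otherwise the clique size
   is limited to c, and s / C(c,j) vertices are added. *)
have [le_ec|lt_ce] := leqP e c.
  have [le_e|lt_e] := leqP d0 e; last first.
    apply: small; rewrite /s0; have := leq_bin2l j lt_e; lia.
  apply: leq_trans (leq_addr _ _); apply: (large e 1) => //.
  - by apply: leq_trans hc1; apply: leq_bin2l.
  - by rewrite mul1n.
  - rewrite muln1; apply: leq_trans (ltnW he2) _; apply: bin_double.
    by rewrite /d0 /J in le_e; nia.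
  apply: hE; first by rewrite /d0 in le_e; lia.
  apply: leq_trans (_ : 'C(e.+1, j) * E <= _).
    by rewrite leq_mul2r (ltnW he2) orbT.
  rewrite -(@leq_pmul2l J) // (mul_bin_left e.+1 j).
  rewrite mulnCA mulnC leq_mul2r; apply/orP; right.
  by rewrite /d0 /J in le_e *; nia.
have hsE : s * E <= n by move: hs; rewrite mulnS; lia.
have [le_c|lt_c] := leqP d0 c; last first.
  apply: small; apply: leq_trans (leq_addl _ _).
  apply: leq_trans (leq_bin2l J lt_c); apply: leq_trans (ltnW hc2).
  by apply: leq_trans hsE; rewrite leq_pmulr.
have hcs : 'C(c, j) <= s by apply: leq_trans he1; apply/leq_bin2l/ltnW.
have cj0 : 0 < 'C(c, j) by rewrite bin_gt0; rewrite /d0 /J in le_c; nia.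
apply: leq_trans (leq_addr _ _); apply: (large c (s %/ 'C(c, j))) => //.
- exact: leq_trunc_div.
- have := ltn_ceil s cj0.
  have : 0 < s %/ 'C(c, j) by rewrite divn_gt0.
  rewrite -mulnA mulSn => m0 /ltnW; rewrite mul2n -addnn => hs'.
  by apply: leq_trans hs' _; rewrite leq_add2r leq_pmull.
- apply: hE; first by rewrite /d0 in le_c; lia.
  exact: leq_trans hsE (ltnW hc2).
Qed.

(** Let c be the clique size of q. Adding q to p as at least about c/(j+1) vertices over a clique on
    c vertices gains (c/(j+1)) C(c,j+1), whereas q alone is worth about (c/(j+2)) C(c,j+1). The
    difference beats the linear term for large c. *)
Lemma split_gain j E M : 0 < j -> exists b0, forall p q,
  b0 <= p + q -> q <= p -> p + q <= E * q ->
  casc j.+1 p + casc j.+1 q + M * (p + q) <= casc j.+1 (p + q).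
Proof.
move=> j0; set J := j.+1.
pose c1 := 2 * J * J + J + 2 * M * E * J * J.+1 + 2 * J.
exists (E * 'C(c1, J)).+1 => p q hb le_qp hE.
have E0 : 0 < E by lia.
have hq : 'C(c1, J) < q by rewrite -(ltn_pmul2l E0); lia.
have /andP[] := casc_topP j q; rewrite -/J; set c := casc_top J q => hc1 hc2.
have le_c : c1 <= c.
  by rewrite leqNgt; apply/negP => /(@leq_bin2l _ _ J); lia.
have cj0 : 0 < 'C(c, j) by rewrite bin_gt0; rewrite /c1 /J in le_c; nia.
pose m := q %/ 'C(c, j).
have h1 : casc J p + m * 'C(c, J) <= casc J (p + m * 'C(c, j)).
  exact: casc_grow m j0 (leq_trans hc1 le_qp).
have h2 : casc J (p + m * 'C(c, j)) <= casc J (p + q).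
  by rewrite casc_mono // leq_add2l leq_trunc_div.
have h3 : casc J q <= 'C(c, J) + 'C(c, J.+1).
  have := casc_mono J (ltnW hc2); rewrite casc_bin // binS; lia.
have h4 : J * 'C(c, J) = (c - j) * 'C(c, j) := mul_bin_left c j.
have h5 := mul_bin_left c J.
have h6 : c - j < m.+1 * J.
  rewrite -(@ltn_pmul2r 'C(c, j)) // -h4 mulnAC [leqRHS]mulnC ltn_pmul2l //.
  exact: leq_ltn_trans hc1 (ltn_ceil q cj0).
have h7 : M * (p + q) <= 2 * M * E * 'C(c, J).
  have : q <= 2 * 'C(c, J).
    apply: leq_trans (ltnW hc2) _; apply: bin_double.
    by rewrite /c1 in le_c; lia.
  move=> h7; rewrite [2 * M]mulnC -!mulnA leq_mul2l; apply/orP; right.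
  apply: leq_trans hE _; rewrite mulnCA leq_mul2l; apply/orP; right.
  exact: h7.
suff h8 : 'C(c, J) + 'C(c, J.+1) + 2 * M * E * 'C(c, J) <= m * 'C(c, J).
  by lia.
rewrite -(@leq_pmul2l (J * J.+1)) // !mulnDr.
have -> : J * J.+1 * 'C(c, J.+1) = J * (c - J) * 'C(c, J).
  by rewrite -mulnA h5 mulnA.
rewrite !mulnA -!mulnDl leq_mul2r; apply/orP; right.
have [w Ew] : exists w, c = J + w by exists (c - J); rewrite /c1 in le_c; lia.
have -> : c - J = w by lia.
have {}h6 : J.+1 * w.+2 <= J.+1 * (m.+1 * J).
  by rewrite leq_mul2l; apply/orP; right; move: h6; rewrite Ew /J; lia.
by rewrite Ew /c1 in le_c; lia.
Qed.

Lemma terminal_bound j R b D : 4 * j.+1 * j.+1 <= R ->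
  2 * j <= casc_top j b -> 0 < j -> D <= casc_top j b %/ R ->
  j.+1 * (D * b) <= casc j b.
Proof.
move=> hR hc j0 hD.
have /andP[h1 h2] : 'C(casc_top j b, j) <= b < 'C((casc_top j b).+1, j).
  by case: (j) j0 => // i _; exact: casc_topP.
move: hc hD h1 h2; set c := casc_top j b => hc hD h1 h2.
have := casc_mono j h1; rewrite casc_bin // => h3.
apply: leq_trans h3.
have h4 := mul_bin_left c j.
have h5 := bin_double hc.
have h6 : 2 * j.+1 * j.+1 * D <= c - j.
  have := leq_trunc_div c R; nia.
rewrite -(@leq_pmul2l j.+1) // h4.
apply: leq_trans (leq_mul h6 (leqnn 'C(c, j))).
have h7 : b <= 2 * 'C(c, j) by lia.
apply: leq_trans (_ : j.+1 * (j.+1 * (D * (2 * 'C(c, j)))) <= _); last by lia.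
by rewrite !leq_mul2l h7 !orbT.
Qed.

(** * Families of subsets of a finite type *)

Lemma card_set_sum (V : finType) (W : {set V}) (P : pred V) :
  #|[set v in W | P v]| = \sum_(v in W) P v.
Proof.
rewrite -sum1_card big_mkcond [in RHS]big_mkcond /=.
by apply: eq_bigr => v _; rewrite inE; case: (v \in W); case: (P v).
Qed.

Lemma double_count (U V : finType) (S : {set U}) (W : {set V})
    (R : U -> V -> bool) a b :
  (forall u, u \in S -> a <= #|[set v in W | R u v]|) ->
  (forall v, v \in W -> #|[set u in S | R u v]| <= b) ->
  a * #|S| <= b * #|W|.
Proof.
move=> ha hb; apply: (@leq_trans (\sum_(u in S) \sum_(v in W) R u v)).
  rewrite mulnC -sum_nat_const; apply: leq_sum => u /ha.
  by rewrite card_set_sum.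
rewrite exchange_big /= mulnC -sum_nat_const; apply: leq_sum => v /hb.
by rewrite card_set_sum.
Qed.

Section Families.

Variable T : finType.
Implicit Types (A B F : {set {set T}}) (X Y Z : {set T}) (x y z : T).

Lemma cover_setU1 X Y : Y \subset X -> #|X| = #|Y|.+1 ->
  exists z, [/\ z \notin Y, X = z |: Y & Y = X :\ z].
Proof.
move=> sYX cX; have : #|X :\: Y| == 1.
  by have := cardsID Y X; rewrite (setIidPr sYX) cX => /eqP; rewrite -addn1 eqn_add2l.
case/cards1P=> z Ez; exists z; have zXY : z \in X :\: Y by rewrite Ez set11.
have zY : z \notin Y by case/setDP: zXY.
have EX : X = z |: Y by rewrite -Ez -{1}(setID X Y) (setIidPr sYX) setUC.
by split=> //; rewrite EX setU1K.
Qed.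

(** A member of [B] covered by X is encoded by the element it omits, so k distinct subsets become k
    elements of X. *)
Definition removable B X := [set x in X | X :\ x \in B].

Definition adm r k A B :=
  (forall X, X \in A -> #|X| = r /\ k <= #|removable B X|) /\
  (forall Y, Y \in B -> #|Y| = r.-1).

Definition star x F := [set X in F | x \in X].
Definition costar x F := [set X in F | x \notin X].
Definition link x F := [set Z : {set T} | (x \notin Z) && (x |: Z \in F)].

Lemma card_star_costar x F : #|star x F| + #|costar x F| = #|F|.
Proof.
rewrite -(cardsID [set X : {set T} | x \in X] F); congr (_ + _); apply: eq_card => X;
  by rewrite !inE // andbC.
Qed.

Lemma card_link x F : #|link x F| = #|star x F|.
Proof.
have <- : [set x |: Z | Z in link x F] = star x F.
  apply/setP=> X; rewrite inE; apply/imsetP/andP => [[Z]|[XF xX]].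
    by rewrite inE => /andP[_ ?] ->; rewrite setU11.
  by exists (X :\ x); rewrite ?inE ?eqxx ?setD1K.
rewrite card_in_imset // => Z1 Z2; rewrite !inE => /andP[h1 _] /andP[h2 _] E.
by rewrite -(setU1K h1) E setU1K.
Qed.

Lemma removable_link x B X : x \in X -> removable (link x B) (X :\ x) = removable B X :\ x.
Proof.
move=> xX; apply/setP=> y; rewrite !inE eqxx /= andbF /=.
have [->|nyx] := eqVneq y x; first by [].
suff -> : x |: (X :\ x :\ y) = X :\ y by [].
by rewrite setDDl [[set x] :|: [set y]]setUC -setDDl setD1K // !inE xX eq_sym nyx.
Qed.

Lemma adm_link r k k' A A' B x : adm r k A B -> A' \subset star x A ->
  (forall X, X \in A' -> k' <= #|removable B X :\ x|) ->
  adm r.-1 k' (link x A') (link x B) /\ #|link x A'| = #|A'|.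
Proof.
move=> [hA hB] /subsetP sA hk; split; last first.
  rewrite card_link; apply: eq_card => X; rewrite inE.
  by case XA: (X \in A') => //=; have := sA _ XA; rewrite inE => /andP[].
split=> Z; rewrite inE => /andP[xZ ZF].
  have := hk _ ZF; rewrite -removable_link ?setU11 // setU1K // => ->; split=> //.
  have := sA _ ZF; rewrite inE => /andP[/hA[<- _] _].
  by rewrite cardsU1 xZ.
by have := hB _ ZF; rewrite cardsU1 xZ => <-.
Qed.

Lemma adm_costar r k A B x : adm r k A B -> adm r k (costar x A) (costar x B).
Proof.
move=> [hA hB]; split=> [X|Y]; rewrite inE => /andP[]; last by move=> /hB.
move=> /hA[-> hk] xX; split=> //; apply: leq_trans hk _; apply: subset_leq_card.
by apply/subsetP=> y; rewrite !inE (negPf xX) andbF /= andbT.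
Qed.

(** Omitting an element other than x keeps x, so these X have k members of [B] through x below them
    and survive in the link of x. *)
Definition core_star k x A B := [set X in star x A | k <= #|removable B X :\ x|].

(** A member X of the star outside the core reaches k only by omitting x itself, so X \ x lies in
    [costar x B], and it determines X. *)
Lemma card_split r k A B x : adm r k A B ->
  #|A| <= #|core_star k x A B| + #|costar x A| + #|costar x B|.
Proof.
move=> [hA hB]; rewrite -(card_star_costar x A) addnAC leq_add2r.
rewrite -(cardsID (core_star k x A B) (star x A)) leq_add //.
  by rewrite subset_leq_card // subsetIr.
have inj : {in star x A &, injective (fun X => X :\ x)}.
  move=> X1 X2; rewrite !inE => /andP[_ h1] /andP[_ h2] E.
  by rewrite -(setD1K h1) E setD1K.
rewrite -(card_in_imset (f := fun X => X :\ x)); last first.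
  by apply: sub_in2 inj => X /setDP[].
apply: subset_leq_card; apply/subsetP=> Y /imsetP[X /setDP[XA XC] ->].
move: XC; rewrite !inE eqxx andbT in XA *; rewrite XA /= -ltnNge.
case/andP: XA => /hA[_ hk] xX; rewrite (cardsD1 x) in hk.
case: (boolP (x \in removable B X)) hk => [|_]; first by rewrite inE => /andP[].
by rewrite add0n => h1 h2; move: (leq_ltn_trans h1 h2); rewrite ltnn.
Qed.

(** * Peeling, degree bounds and Kruskal-Katona *)

Definition above A Y := [set X in A | Y \subset X].

Lemma adm_peel r k A B Y : adm r k A B -> adm r k (A :\: above A Y) (B :\ Y).
Proof.
move=> [hA hB]; split=> [X|Z]; last by case/setD1P=> _ /hB.
case/setDP=> XA; rewrite inE XA /= => hY; have [-> hk] := hA _ XA; split=> //.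
apply: leq_trans hk _; apply: subset_leq_card; apply/subsetP=> x.
rewrite !inE => /andP[-> ->]; rewrite !andbT /=.
by apply: contraNneq hY => <-; apply: subsetDl.
Qed.

Lemma card_peel A Y : #|A :\: above A Y| + #|above A Y| = #|A|.
Proof.
rewrite addnC -[RHS](cardsID (above A Y) A); congr (#|pred_of_set _| + _).
by apply/setP=> X; rewrite !inE; case: (X \in A).
Qed.

Lemma adm_card r k A B X Y : adm r k A B -> 0 < r -> X \in A -> Y \in B ->
  #|X| = #|Y|.+1.
Proof. by move=> [hA hB] r0 /hA[-> _] /hB ->; rewrite prednK. Qed.

Lemma adm_set0 r k A B : adm r k A B -> 0 < k -> B = set0 -> A = set0.
Proof.
move=> [hA _] k0 B0; apply/setP=> X; rewrite inE; apply/negP=> /hA[_].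
rewrite (_ : removable B X = set0) ?cards0; first lia.
by apply/setP=> x; rewrite B0 !inE andbF.
Qed.

Lemma adm_gt r k A B : adm r k A B -> r < k -> A = set0.
Proof.
move=> [hA _] h; apply/setP=> X; rewrite inE; apply/negP=> /hA[hX].
have : #|removable B X| <= #|X| by apply: subset_leq_card; apply/subsetP=> x; rewrite inE => /andP[].
lia.
Qed.

(** Two distinct members of [B] below X have union X, so peeling off Y costs at most one X for each
    other member of [B]. *)
Lemma kruskal_katona2 r A B : adm r 2 A B -> #|A| <= 'C(#|B|, 2).
Proof.
elim/ltn_ind: {B}#|B| {-2}B (erefl #|B|) A => b IH B Eb A adA.
have [B0|[Y YB]] := set_0Vmem B.
  by rewrite (adm_set0 adA) // cards0.
have [r0|r0] := posnP r.
  by rewrite (adm_gt adA) ?cards0 ?r0.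
have cB := cardsD1 Y B; rewrite YB Eb in cB.
have := IH #|B :\ Y| _ _ erefl _ (adm_peel Y adA).
rewrite -(card_peel A Y) Eb cB /= add1n binS bin1 => h.
apply: leq_add; first by apply: h.
apply: leq_trans (_ : #|[set Y :|: Z | Z in B :\ Y]| <= _); last first.
  exact: leq_imset_card.
apply: subset_leq_card; apply/subsetP=> X; rewrite inE => /andP[XA YX].
have [z [zY EX EY]] := cover_setU1 YX (adm_card adA r0 XA YB).
have [hA _] := adA; have [_] := hA _ XA; rewrite (cardsD1 z).
have : 0 < #|removable B X :\ z| -> X \in [set Y :|: Z | Z in B :\ Y].
  rewrite card_gt0 => /set0Pn[y]; rewrite !inE => /and3P[yz yX yB].
  apply/imsetP; exists (X :\ y); first rewrite !inE yB andbT EY.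
    apply/eqP=> /setP/(_ y); rewrite !inE eqxx yX yz.
    done.
  apply/setP=> w; rewrite EY !inE.
  have [->|_] := eqVneq w y; first by rewrite yz yX.
  by case: (w \in X); rewrite ?andbF ?orbT.
move=> hh h2; apply: hh; move: h2; case: (_ \in _) => /=; lia.
Qed.

(* Starting from Y0, exchange elements of Y0 for new ones, one at a time: N i is the
   set of members of B reached after i exchanges. *)
Section Crude.

Variables (r k : nat) (A B : {set {set T}}) (Y0 : {set T}) (D : nat).
Hypotheses (adA : adm r k A B) (r0 : 0 < r) (Y0B : Y0 \in B).
Hypothesis degD : forall Y, Y \in B -> D <= #|above A Y|.

Let N i := [set Y in B | #|Y :\: Y0| == i].
Let M i := [set X in A | #|X :\: Y0| == i.+1].

Let cardB Y : Y \in B -> #|Y0 :\: Y| = #|Y :\: Y0|.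
Proof.
move=> YB; have [_ hB] := adA.
have := cardsID Y Y0; have := cardsID Y0 Y; rewrite (hB _ YB) (hB _ Y0B) setIC; lia.
Qed.

(** Count pairs Y in X. At most i of the supersets of Y add an element of [Y0], and Y arises from X
    by omitting one of the i+1 elements of X outside [Y0]. *)
Let step1 i : (D - i) * #|N i| <= i.+1 * #|M i|.
Proof.
apply: (double_count (R := fun Y X => Y \subset X)) => [Y|X]; rewrite inE.
  move=> /andP[YB /eqP Yi]; rewrite leq_subLR -{1}Yi -cardB //.
  apply: leq_trans (degD YB) _.
  apply: leq_trans (_ : #|[set z |: Y | z in Y0 :\: Y] :|: [set X in M i | Y \subset X]| <= _).
    apply: subset_leq_card; apply/subsetP=> X; rewrite inE => /andP[XA YX].
    have [z [zY EX _]] := cover_setU1 YX (adm_card adA r0 XA YB).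
    rewrite in_setU; case: (boolP (z \in Y0)) => zY0; apply/orP; [left|right].
      by apply/imsetP; exists z; rewrite // inE zY.
    rewrite !inE XA YX andbT /= EX setDUl.
    have -> : [set z] :\: Y0 = [set z].
      by apply/setDidPl; rewrite disjoints1.
    by rewrite cardsU1 inE (negPf zY) andbF Yi.
  apply: leq_trans (leq_card_setU _ _) _; rewrite leq_add2r.
  exact: leq_imset_card.
move=> /andP[XA /eqP Xi]; rewrite -Xi.
apply: leq_trans (leq_imset_card (fun z => X :\ z) _).
apply: subset_leq_card; apply/subsetP=> Y; rewrite !inE => /andP[/andP[YB /eqP Yi] YX].
have [z [zY EX EY]] := cover_setU1 YX (adm_card adA r0 XA YB).
have zX : z \in X by rewrite EX setU11.
apply/imsetP; exists z => //; rewrite !inE zX andbT.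
apply/negP=> zY0; move: Xi; rewrite EX setDUl.
have -> : [set z] :\: Y0 = set0 by apply/eqP; rewrite setD_eq0 sub1set.
by rewrite set0U Yi; lia.
Qed.

(** X has only i+1 < k elements outside [Y0], so some removable element lies in [Y0]; conversely Y
    lacks just i+1 elements of [Y0], and X adds one of them. *)
Let step2 i : i.+1 < k -> #|M i| <= i.+1 * #|N i.+1|.
Proof.
move=> ik; rewrite -[leqLHS]mul1n.
apply: (double_count (R := fun X Y => Y \subset X)) => [X|Y]; rewrite inE.
  move=> /andP[XA /eqP Xi]; have [hA _] := adA; have [_ hk] := hA _ XA.
  have : ~~ (removable B X \subset X :\: Y0).
    by apply/negP=> /subset_leq_card; lia.
  case/subsetPn=> x; rewrite !inE => /andP[xX xB]; rewrite xX andbT negbK => xY0.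
  rewrite card_gt0; apply/set0Pn; exists (X :\ x).
  rewrite !inE xB subsetDl andbT -Xi; apply/eqP.
  apply: eq_card => y; rewrite !inE.
  by have [->|] := eqVneq y x; rewrite ?xY0 // andTb.
move=> /andP[YB /eqP Yi]; rewrite -Yi -cardB //.
apply: leq_trans (leq_imset_card (fun z => z |: Y) _).
apply: subset_leq_card; apply/subsetP=> X; rewrite !inE => /andP[/andP[XA /eqP Xi] YX].
have [z [zY EX EY]] := cover_setU1 YX (adm_card adA r0 XA YB).
apply/imsetP; exists z => //; rewrite !inE zY /=.
apply/negPn/negP=> zY0; move: Xi; rewrite EX setDUl.
have -> : [set z] :\: Y0 = [set z] by apply/setDidPl; rewrite disjoints1.
by rewrite cardsU1 inE (negPf zY) andbF Yi; lia.
Qed.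

Lemma min_degree_bound : 0 < k -> 'C(D, k.-1) <= #|B| * (k.-1)`!.
Proof.
move=> k0.
have H i : i < k -> D ^_ i <= i`! * i`! * #|N i|.
  elim: i => [_|i IH ik].
    rewrite muln1 mul1n ffactn0 card_gt0; apply/set0Pn; exists Y0.
    by rewrite inE Y0B setDv cards0.
  rewrite ffactnSr; apply: leq_trans (leq_mul (IH (ltnW ik)) (leqnn _)) _.
  have h1 := step1 i; have h2 := step2 ik.
  rewrite -mulnA [#|N i| * _]mulnC !factS.
  apply: leq_trans (leq_mul (leqnn _) h1) _.
  have h3 : i.+1 * #|M i| <= i.+1 * (i.+1 * #|N i.+1|) by rewrite leq_mul2l h2 orbT.
  apply: leq_trans (leq_mul (leqnn _) h3) _.
  by rewrite eq_leq //; lia.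
have f0 := fact_gt0 k.-1.
rewrite -(leq_pmul2r f0) bin_ffact; apply: leq_trans (H k.-1 _) _.
  by rewrite prednK.
rewrite [leqRHS]mulnC mulnA [leqRHS]mulnAC leq_mul2l; apply/orP; right.
by apply: subset_leq_card; apply/subsetP=> Y; rewrite inE => /andP[].
Qed.

End Crude.

(** Peel off members of [B] with fewer than D sets above them; [min_degree_bound] rules out a
    nonempty remainder with all degrees at least D. *)
Lemma crude_bound_degree r k A B D : adm r k A B -> 0 < k ->
  #|B| * (k.-1)`! < 'C(D, k.-1) -> #|A| <= #|B| * D.
Proof.
move=> adA k0.
elim/ltn_ind: {B}#|B| {-2}B (erefl #|B|) A adA => b IH B Eb A adA hb.
have [B0|[Y0 Y0B]] := set_0Vmem B.
  by rewrite (adm_set0 adA) // cards0.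
have [rk|rk] := ltnP r k; first by rewrite (adm_gt adA rk) cards0.
case: (boolP [forall Y in B, D <= #|above A Y|]) => [/forall_inP hD|].
  have := min_degree_bound adA (leq_trans k0 rk) Y0B hD k0; lia.
rewrite negb_forall_in => /exists_inP[Y YB]; rewrite -ltnNge => hY.
have cB := cardsD1 Y B; rewrite YB Eb in cB.
have := IH #|B :\ Y| _ _ erefl _ (adm_peel Y adA); rewrite -(card_peel A Y).
rewrite Eb cB add1n mulSn => h; rewrite addnC leq_add //; first exact: ltnW.
apply: h; first by [].
by apply: leq_ltn_trans hb; rewrite leq_mul2r Eb cB leq_addl orbT.
Qed.

Lemma crude_bound r j A B : adm r j.+1 A B -> 0 < j -> #|A| <= crude j #|B|.
Proof. by move=> adA j0; apply: (crude_bound_degree adA) => //; exact: crude_degP. Qed.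

(** Split at x. The star of [A] is bounded through the link, by induction, and also by the costar of
    [B], since r = k puts every X \ x in [B]; [add_vertex] combines the two. *)
Lemma kruskal_katona j A B : adm j.+1 j.+1 A B -> 0 < j -> #|A| <= casc j #|B|.
Proof.
elim: j A B => // -[_ A B adA _|j IHj A B adA _]; first by rewrite casc1 (kruskal_katona2 adA).
elim/ltn_ind: {B}#|B| {-2}B (erefl #|B|) A adA => b IH B Eb A adA.
have [B0|[Y YB]] := set_0Vmem B.
  by rewrite (adm_set0 adA) // cards0.
have [hA hB] := adA.
have : 0 < #|Y| by rewrite hB.
rewrite card_gt0 => /set0Pn[x xY].
have cB := card_star_costar x B; rewrite Eb in cB.
have y0 : 0 < #|star x B|.
  by rewrite card_gt0; apply/set0Pn; exists Y; rewrite inE YB.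
have ltb : #|costar x B| < b by lia.
have hco := IH _ ltb _ erefl _ (adm_costar x adA).
have [|adl cl] := @adm_link _ _ j.+2 A (star x A) B x adA (subxx _).
  move=> X; rewrite inE => /andP[/hA[_ h] _]; rewrite (cardsD1 x) in h.
  by case: (_ \in _) h => /=; lia.
have hst := IHj _ _ adl isT; rewrite cl card_link in hst.
have hst' : #|star x A| <= #|costar x B|.
  rewrite -(card_in_imset (f := fun X => X :\ x) (D := mem (star x A))).
    apply: subset_leq_card; apply/subsetP=> Z /imsetP[X]; rewrite inE => /andP[XA xX] ->.
    rewrite !inE eqxx /= andbT; have [cX hX] := hA _ XA.
    have : removable B X == X.
      by rewrite eqEcard cX hX andbT; apply/subsetP=> y; rewrite inE => /andP[].
    by move=> /eqP/setP/(_ x); rewrite inE xX.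
  move=> X1 X2; rewrite !inE => /andP[_ h1] /andP[_ h2] E.
  by rewrite -(setD1K h1) E setD1K.
have [ew _ _] := casc_inequalities j.+1.
have := ew #|costar x B| #|star x B|.
rewrite Eb /link_cap [_ + #|star x B|]addnC cB -(card_star_costar x A).
by apply: leq_trans; rewrite addnC leq_add // leq_min hst.
Qed.

(** Each X is in the core star of at least r-k elements: all its elements if more than k are
    removable, else the non-removable ones. Summing crude bounds over the links gives (r-k) |A| <= D
    (r-1) |B|. *)
Lemma core_terminal r k A B D : adm r k A B -> 0 < k -> k < r ->
  (forall x, #|star x B| * (k.-1)`! < 'C(D, k.-1)) -> #|A| <= k * (D * #|B|).
Proof.
move=> adA k0 kr hD; have [hA hB] := adA.
have h1 : (r - k) * #|A| <= \sum_x #|core_star k x A B|.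
  rewrite mulnC -sum_nat_const.
  under [leqRHS]eq_bigr => x _ do rewrite card_set_sum big_mkcond /=.
  rewrite exchange_big /= [leqLHS]big_mkcond leq_sum // => X _.
  case: ifP => // XA; have [cX hk] := hA _ XA.
  have [hlt|hge] := ltnP k #|removable B X|.
    apply: leq_trans (leq_subr _ _) _; rewrite -cX -sum1_card big_mkcond leq_sum // => x _.
    rewrite inE XA /=; case: ifP => // xX.
    rewrite (_ : (k <= _) = true) //; rewrite (cardsD1 x) in hlt.
    by case: (_ \in _) hlt => /=; lia.
  have Ek : #|removable B X| = k by apply/eqP; rewrite eqn_leq hge hk.
  have sX : removable B X \subset X by apply/subsetP=> x; rewrite inE => /andP[].
  have -> : r - k = #|X :\: removable B X|.
    by rewrite cardsD (setIidPr sX) cX Ek.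
  rewrite -sum1_card big_mkcond leq_sum // => x _.
  case: ifP => //; rewrite in_setD => /andP[xd xX]; rewrite inE XA xX /=.
  rewrite (_ : removable B X :\ x = removable B X) ?hk //.
  by apply/setDidPl; rewrite disjoint_sym disjoints1.
have h2 x : #|core_star k x A B| <= D * #|star x B|.
  have [||adl <-] := @adm_link _ _ k A (core_star k x A B) B x adA.
  - by apply/subsetP=> X; rewrite inE => /andP[].
  - by move=> X; rewrite inE => /andP[].
  rewrite -card_link mulnC; apply: (crude_bound_degree adl) => //.
  by rewrite card_link.
have h3 : \sum_x #|star x B| = r.-1 * #|B|.
  under eq_bigr => x _ do rewrite card_set_sum.
  rewrite exchange_big /= mulnC -sum_nat_const; apply: eq_bigr => Y /hB <-.
  by rewrite -sum1_card [in RHS]big_mkcond; apply: eq_bigr => x _; case: (x \in Y).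
have h4 : (r - k) * #|A| <= D * (r.-1 * #|B|).
  rewrite -h3 big_distrr /=; apply: leq_trans h1 _.
  by apply: leq_sum => x _; apply: h2.
have rk0 : 0 < r - k by rewrite subn_gt0.
rewrite -(leq_pmul2l rk0); apply: leq_trans h4 _.
(* This makes the bound independent of r. *)
have h5 : r.-1 <= (r - k) * k.
  have [w ->] : exists w, r = k + w.+1 by exists (r - k.+1); lia.
  by rewrite addKn; case: (k) k0 => // i _; rewrite addSn /=; nia.
apply: leq_trans (leq_mul (leqnn D) (leq_mul h5 (leqnn #|B|))) _.
by rewrite eq_leq //; lia.
Qed.

End Families.

(** * The upper bound *)

(** One [E] must serve both the removal estimate and the classification by stars. The factor 2 in
    the last case is slack: when accumulated discards first exceed that threshold, the removal
    estimate still applies. *)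
Lemma trichotomy j : 0 < j -> exists E,
  (forall M, exists tau, forall n s, s * E <= n + s ->
     casc j.+1 n + M * s + crude j.+1 s <= casc j.+1 (n + s) + tau) /\
  (forall M, exists b1, forall (T : finType) r (A B : {set {set T}}),
     adm r j.+2 A B -> j.+2 < r -> b1 <= #|B| ->
     [\/ #|A| <= casc j.+1 #|B|,
         exists x, [/\ 0 < #|star x B|, 0 < #|costar x B| &
           casc j.+1 #|star x B| + casc j.+1 #|costar x B| + M * #|B|
             <= casc j.+1 #|B|] |
         exists x, #|costar x B| * (2 * E) <= #|B|]).
Proof.
move=> j0; pose R := 4 * j.+2 * j.+2.
have [|//|E [c0 [E0 hE]]] := @crude_deg_small j.+1 R _ _; [by []|].
exists E.+1; split.
  by move=> M; apply: (@removal_gain j R E c0); rewrite // /R; nia.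
move=> M; set E2 := 2 * E.+1.
have [b0 hb0] := split_gain E2 M j0.
exists (b0 + 'C(c0 + 2 * j.+1, j.+1)) => T r A B adA kr hb.
case: (boolP [forall x, #|star x B| * E2 <= #|B|]) => [/forallP hx|].
  apply: Or31; have /andP[_ hc] := casc_topP j #|B|.
  move: hc; set c := casc_top _ _ => hc.
  have hcc : c0 + 2 * j.+1 <= c.
    rewrite leqNgt; apply/negP => /(@leq_bin2l _ _ j.+1); lia.
  pose D := c %/ R.
  have hD x : #|star x B| * (j.+1)`! < 'C(D, j.+1).
    apply: leq_trans (crude_degP _ _) _ => //; apply: leq_bin2l.
    apply: hE; first by lia.
    by apply: leq_trans (ltnW hc); apply: leq_trans (hx x); rewrite leq_mul2l /E2; lia.
  apply: leq_trans (core_terminal adA _ kr hD) _ => //.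
  by apply: (@terminal_bound j.+1 R #|B| D) => //; rewrite -/c; lia.
rewrite negb_forall => /existsP[x]; rewrite -ltnNge => hx.
have [h|h] := leqP (#|costar x B| * E2) #|B|; first by apply: Or33; exists x.
apply: Or32; exists x; have cB := card_star_costar x B.
have p0 : 0 < #|star x B| by case: #|star x B| hx => //; lia.
have q0 : 0 < #|costar x B| by case: #|costar x B| h => //; lia.
split=> //; rewrite -[in M * _]cB -[in leqRHS]cB.
have [le_qp|/ltnW le_pq] := leqP #|costar x B| #|star x B|.
  by apply: hb0; rewrite // cB; lia.
rewrite [casc _ _ + _]addnC [_ + #|costar x B|]addnC.
by apply: hb0; rewrite // addnC cB; lia.
Qed.

Lemma adm_core r k (T : finType) (A B : {set {set T}}) x : adm r k A B ->
  adm r.-1 k (link x (core_star k x A B)) (link x B) /\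
  #|link x (core_star k x A B)| = #|core_star k x A B|.
Proof.
move=> adA; apply: (adm_link adA).
  by apply/subsetP=> X; rewrite inE => /andP[].
by move=> X; rewrite inE => /andP[].
Qed.

(** A first pass with linear error, uniform in r. The extra |B| won by a balanced split pays for the
    costar of [B], a nonempty costar absorbs the additive constant of a removal, and [crude_deg]
    covers small |B|. *)
Lemma linear_bound j : 0 < j -> exists M,
  forall (T : finType) r (A B : {set {set T}}), adm r j.+2 A B ->
  #|A| <= casc j.+1 #|B| + M * #|B|.
Proof.
move=> j0; have [E [hrem htri]] := trichotomy j0.
have [tau ht] := hrem 1; have [b1 hb1] := htri 1.
exists (tau + crude_deg j.+1 b1) => T; set M := _ + _.
elim/ltn_ind => r IHr A B adA.
elim/ltn_ind: {B}#|B| {-2}B (erefl #|B|) A adA => b IH B Eb A adA.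
have [rk|kr|rk] := ltngtP r j.+2.
- by rewrite (adm_gt adA rk) cards0.
- have [hb|hb] := ltnP #|B| b1.
    apply: leq_trans (crude_bound adA isT) _; apply: leq_trans (leq_addl _ _).
    rewrite /crude mulnC leq_mul2r; apply/orP; right.
    by apply: leq_trans (crude_deg_mono _ (ltnW hb)) (leq_addl _ _).
  have hcore x : #|core_star j.+2 x A B| <=
      casc j.+1 #|star x B| + M * #|star x B|.
    have [adl <-] := adm_core x adA; rewrite -card_link.
    by apply: (IHr r.-1) adl; lia.
  case: (hb1 _ _ _ _ adA kr hb) => [h|[x [p0 q0 hx]]|[x hx]].
  + by apply: leq_trans h (leq_addr _ _).
  + have cB := card_star_costar x B.
    apply: leq_trans (card_split x adA) _.
    have h1 := hcore x.
    have h2 : #|costar x A| <= casc j.+1 #|costar x B| + M * #|costar x B|.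
      by apply: (IH _ _ _ erefl _ (adm_costar x adA)); lia.
    have : M * #|B| = M * #|star x B| + M * #|costar x B| by rewrite -cB mulnDr.
    by lia.
  + have cB := card_star_costar x B.
    apply: leq_trans (card_split x adA) _.
    have h1 := hcore x.
    have h2 := crude_bound (adm_costar x adA) isT.
    have [s0|s0] := posnP #|costar x B|.
      by move: h2 cB; rewrite s0 /crude mul0n addn0 => h2 <-; lia.
    have h3 := ht #|star x B| #|costar x B| _.
    rewrite cB in h3; have {}h3 := h3 ltac:(lia).
    have : M * #|B| = M * #|star x B| + M * #|costar x B| by rewrite -cB mulnDr.
    have : tau <= M * #|costar x B|.
      by rewrite -[leqLHS]muln1; apply: leq_mul => //; exact: leq_addr.
    by lia.
- rewrite rk in adA; apply: leq_trans (kruskal_katona adA isT) (leq_addr _ _).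
Qed.

(* s counts the members of B already discarded in earlier links. *)
Lemma removal_bound j : 0 < j -> exists E tau,
  forall (T : finType) r (A B : {set {set T}}) s, adm r j.+2 A B ->
  s * E <= #|B| + s ->
  #|A| + s + crude j.+1 s <= casc j.+1 (#|B| + s) + tau.
Proof.
move=> j0; have [E [hrem htri]] := trichotomy j0.
(* With [M.+1] a balanced split pays the linear errors of both parts and the costar of [B]. *)
have [M hM] := linear_bound j0; have [b1 hb1] := htri M.+1.
have [tau1 ht1] := hrem 1; have [tau2 ht2] := hrem (2 * E * M).+1.
exists (2 * E), (tau1 + tau2 + M * b1) => T.
elim/ltn_ind => r IHr A B s adA hs.
have {}ht1 := ht1 #|B| s ltac:(lia).
have main m : #|A| <= casc j.+1 #|B| + m -> m <= M * b1 ->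
    #|A| + s + crude j.+1 s <= casc j.+1 (#|B| + s) + (tau1 + tau2 + M * b1).
  by lia.
have [rk|kr|rk] := ltngtP r j.+2.
- by apply: (main 0) => //; rewrite (adm_gt adA rk) cards0.
- have [hb|hb] := ltnP #|B| b1.
    by apply: main (hM _ _ _ _ adA) _; rewrite leq_mul2l ltnW ?orbT.
  case: (hb1 _ _ _ _ adA kr hb) => [h|[x [p0 q0 hx]]|[x hx]].
  + by apply: (main 0); rewrite ?addn0.
  + apply: (main 0) => //; rewrite addn0.
    have cB := card_star_costar x B.
    apply: leq_trans (card_split x adA) _.
    have [adl h1] := adm_core x adA.
    have := hM _ _ _ _ adl; rewrite h1 card_link.
    have := hM _ _ _ _ (adm_costar x adA).
    have : M.+1 * #|B| = M * #|star x B| + M * #|costar x B| + #|B|.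
      by rewrite -mulnDr cB mulSn addnC.
    by lia.
  + have cB := card_star_costar x B.
    have h1 := card_split x adA.
    have h2 := crude_bound (adm_costar x adA) isT.
    have [adl h3] := adm_core x adA.
    have h4 := crude_add #|costar x B| s (ltn0Sn j).
    set q := #|costar x B| in cB h1 h2 h4 hx *.
    have Eb : #|star x B| + (q + s) = #|B| + s by lia.
    (* Within the threshold the link inherits the total q + s. Otherwise the recursion stops: the
       linear error is at most 2EM(q + s), paid by [ht2], which applies because (q + s)E <= |B| +
       s. *)
    have [hqs|hqs] := leqP ((q + s) * (2 * E)) (#|B| + s).
      have hr : r.-1 < r by lia.
      have := IHr _ hr _ _ (q + s) adl; rewrite card_link Eb h3 => /(_ hqs).
      by lia.
    have := ht2 #|star x B| (q + s); rewrite Eb => h5.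
    have {}h5 := h5 ltac:(nia).
    have := hM _ _ _ _ adl; rewrite h3 card_link => h6.
    have h7 : M * #|star x B| <= 2 * E * M * (q + s).
      rewrite -mulnA mulnCA leq_mul2l; apply/orP; right.
      by rewrite mulnC; lia.
    by lia.
- by rewrite rk in adA; apply: (main 0) => //; rewrite addn0 (kruskal_katona adA).
Qed.

Lemma adm_upper k : 1 < k -> exists tau,
  forall (T : finType) r (A B : {set {set T}}), adm r k A B ->
  #|A| <= casc k.-1 #|B| + tau.
Proof.
case: k => [|[|[|j]]] // _.
  by exists 0 => T r A B adA; rewrite casc1 addn0 (kruskal_katona2 adA).
have [E [tau h]] := removal_bound (ltn0Sn j).
exists tau => T r A B adA; have := h _ _ _ _ 0 adA.
by rewrite /crude mul0n !addn0; apply.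
Qed.

(** * Transfer to finite sets of natural numbers *)

(** By Pascal's rule the lower blocks of a strictly increasing c never complete the next binomial,
    so [c j.+1] is the greedy top. *)
Lemma cascade_lt c j : (forall i, 0 < i -> i <= j -> c i < c i.+1) ->
  \sum_(1 <= i < j.+2) 'C(c i, i) < 'C((c j.+1).+1, j.+1).
Proof.
elim: j => [|j IHj] hc; rewrite big_nat_recr //= binS addnC ltn_add2l.
  by rewrite big_geq // bin0.
apply: leq_trans (IHj _) _; first by move=> i i0 /leqW; apply: hc.
exact/leq_bin2l/hc.
Qed.

Lemma casc_cascade c j : (forall i, 0 < i -> i < j -> c i < c i.+1) ->
  casc j (\sum_(1 <= i < j.+1) 'C(c i, i)) = \sum_(1 <= i < j.+1) 'C(c i, i.+1).
Proof.
elim: j => [|j IHj] hc; first by rewrite !big_geq.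
have hlt := @cascade_lt c j hc.
rewrite (@casc_eq _ _ (c j.+1)); last first.
  by rewrite hlt andbT big_nat_recr //= leq_addl.
rewrite big_nat_recr // [in RHS]big_nat_recr //= addnK addnC IHj //.
by move=> i i0 /leqW; apply: hc.
Qed.

(** * Families attaining the cascade value *)

Definition initial N c := [set i : 'I_N | i < c].

Lemma card_initial N c : c <= N -> #|initial N c| = c.
Proof.
move=> le_cN; rewrite -[RHS]card_ord.
have <- : [set widen_ord le_cN i | i : 'I_c] = initial N c.
  apply/setP=> i; rewrite inE; apply/imsetP/idP => [[i' _ ->] //=|h].
  by exists (Ordinal h) => //; apply: val_inj.
by rewrite card_imset // => i1 i2 /(congr1 val) /= /val_inj.
Qed.

(** Initial colexicographic segments: all sets inside the first d points, then the point d joined to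
    a recursively built family for t. *)
Lemma casc_family N j n c : c < N -> n <= 'C(c, j) ->
  exists A B : {set {set 'I_N}}, [/\ #|B| = n, #|A| = casc j n,
    forall Y, Y \in B -> Y \subset initial N c /\ #|Y| = j &
    forall X, X \in A -> [/\ X \subset initial N c, #|X| = j.+1 &
      forall x, x \in X -> X :\ x \in B]].
Proof.
elim: j n c => [|j IHj] n c cN hn.
  exists set0, (if n == 0 then set0 else [set set0]); split.
  - by rewrite bin0 in hn; case: n hn => [|[]] //; rewrite ?cards0 ?cards1.
  - by rewrite cards0.
  - move=> Y; case: ifP => _; rewrite !inE // => /eqP ->.
    by rewrite sub0set cards0.
  - by move=> X; rewrite inE.
have [->|n0] := posnP n.
  by exists set0, set0; split; rewrite ?cards0 ?casc0 // => ?; rewrite inE.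
have [d [t [En ht]]] := casc_split j n.
have le_dc : d <= c.
  rewrite leqNgt; apply/negP=> /(@leq_bin2l _ _ j.+1); rewrite binS => h.
  have := mul_bin_left c j; have := bin_gt0 c j; have := bin_gt0 c j.+1; lia.
have lt_dc : 0 < t -> d < c.
  move=> t0; rewrite ltn_neqAle le_dc andbT; apply/eqP=> E; subst d; lia.
have dN : d < N by apply: leq_ltn_trans cN.
have [A' [B' [cB cA hB hA]]] := IHj t d dN (ltnW ht).
pose z : 'I_N := Ordinal dN.
have zI (Z : {set 'I_N}) : Z \subset initial N d -> z \notin Z.
  by move=> sZ; apply/negP=> /(subsetP sZ); rewrite inE ltnn.
have IS : initial N d \subset initial N c.
  by apply/subsetP=> i; rewrite !inE => h; apply: leq_trans le_dc.
have IS' : 0 < t -> z |: initial N d \subset initial N c.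
  by move=> /lt_dc h; rewrite subUset IS andbT sub1set inE.
have cU i (F : {set {set 'I_N}}) : (forall Z, Z \in F -> z \notin Z) ->
    #|[set Z : {set 'I_N} | Z \subset initial N d & #|Z| == i] :|:
      [set z |: Z | Z in F]| = 'C(d, i) + #|F|.
  move=> hF; rewrite cardsU cards_draws card_initial ?(ltnW dN) //.
  rewrite card_in_imset; last first.
    by move=> Z1 Z2 /hF h1 /hF h2 E; rewrite -(setU1K h1) E setU1K.
  rewrite (_ : _ :&: _ = set0) ?cards0 ?subn0 //.
  apply/setP=> Z; rewrite !inE; apply/negP=> /andP[/andP[/zI hz _] /imsetP[Z' _ E]].
  by rewrite E setU11 in hz.
exists ([set Z : {set 'I_N} | Z \subset initial N d & #|Z| == j.+2] :|:
        [set z |: Z | Z in A']).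
exists ([set Z : {set 'I_N} | Z \subset initial N d & #|Z| == j.+1] :|:
        [set z |: Z | Z in B']).
split.
- by rewrite cU ?cB // => Z /hB[/zI].
- rewrite cU => [|Z /hA[/zI] //]; rewrite cA.
  by rewrite (@casc_eq _ _ d) ?binS ?En ?addKn //; lia.
- move=> Y; rewrite !inE => /orP[/andP[h /eqP ->]|/imsetP[Z ZB ->]].
    by rewrite (subset_trans h IS).
  have t0 : 0 < t by rewrite -cB card_gt0; apply/set0Pn; exists Z.
  have [h1 h2] := hB _ ZB; rewrite cardsU1 (zI _ h1) h2; split=> //.
  by apply: subset_trans (IS' t0); apply: setUS.
move=> X; rewrite !inE => /orP[/andP[h /eqP cX]|/imsetP[Z ZA EX]].
  rewrite (subset_trans h IS) cX; split=> // x xX; rewrite !inE.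
  rewrite (subset_trans (subsetDl _ _) h) /=.
  by move: cX; rewrite (cardsD1 x) xX add1n => -[->]; rewrite eqxx.
have [h1 h2 h3] := hA _ ZA.
have t0 : 0 < t.
  have : 0 < #|Z| by rewrite h2.
  by rewrite card_gt0 => /set0Pn[x /h3 xB]; rewrite -cB card_gt0; apply/set0Pn; exists (Z :\ x).
rewrite EX cardsU1 (zI _ h1) h2; split=> //.
  by apply: subset_trans (IS' t0); apply: setUS.
move=> x; have [->|nxz] := eqVneq x z.
  by move=> _; apply/setUP; left; rewrite (setU1K (zI _ h1)) inE h1 h2 /=.
rewrite !inE (negPf nxz) /= => xZ; apply/orP; right; apply/imsetP.
exists (Z :\ x); first exact: h3.
apply/setP=> y; rewrite !inE; have [->|//] := eqVneq y x.
by rewrite (negPf nxz).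
Qed.

(** * Passage between finite types and the natural numbers *)

Local Open Scope fset_scope.

Definition fset_of N (Z : {set 'I_N}) : {fset nat} := [fset val i | i in Z].

Lemma in_fset_of N (Z : {set 'I_N}) (i : 'I_N) : (val i \in fset_of Z) = (i \in Z).
Proof.
apply/imfsetP/idP => [[i' /= h /val_inj ->] //|h].
by exists i.
Qed.

Lemma fset_of_lt N (Z : {set 'I_N}) a : a \in fset_of Z -> a < N.
Proof. by case/imfsetP=> i _ ->; apply: ltn_ord. Qed.

Lemma fset_of_inj N : injective (@fset_of N).
Proof. by move=> Z1 Z2 E; apply/setP=> i; rewrite -!in_fset_of E. Qed.

Lemma card_fset_of N (Z : {set 'I_N}) : #|` fset_of Z| = #|Z|.
Proof. by rewrite card_imfset /= ?cardE //; apply: val_inj. Qed.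

Lemma fset_ofD1 N (Z : {set 'I_N}) (i : 'I_N) :
  fset_of (Z :\ i) = fset_of Z `\ val i.
Proof.
apply/fsetP=> a; rewrite !inE; have [aN|aN] := ltnP a N; last first.
  have h (W : {set 'I_N}) : a \in fset_of W = false.
    by apply/negP=> /fset_of_lt; lia.
  by rewrite !h andbF.
by rewrite -[a]/(val (Ordinal aN)) !in_fset_of !inE.
Qed.

Lemma fset_of_surj N (X : {fset nat}) : (forall a, a \in X -> a < N) ->
  exists Z : {set 'I_N}, fset_of Z = X.
Proof.
move=> h; exists [set i : 'I_N | val i \in X]; apply/fsetP=> a.
apply/imfsetP/idP => [[i /=] | aX]; first by rewrite inE => ? ->.
by exists (Ordinal (h a aX)); rewrite //= inE.
Qed.

Lemma fsets_bounded (F : {fset {fset nat}}) :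
  exists N, forall X a, X \in F -> a \in X -> a < N.
Proof.
exists (\max_(X <- F) \max_(a <- X) a).+1 => X a XF aX; rewrite ltnS.
apply: leq_trans (leq_bigmax_seq (F := fun Y : {fset nat} => \max_(i <- Y) i) X XF isT).
exact: (leq_bigmax_seq (F := id) a aX isT).
Qed.

Lemma card_preim_fset_of N (F : {fset {fset nat}}) :
  (forall X a, X \in F -> a \in X -> a < N) ->
  #|[set Z : {set 'I_N} | fset_of Z \in F]| = #|` F|.
Proof.
move=> hF; have -> : F = [fset fset_of Z | Z in [set Z : {set 'I_N} | fset_of Z \in F]].
  apply/fsetP=> X; apply/idP/imfsetP => [XF|[Z /=]]; last by rewrite inE => ? ->.
  have [Z EZ] := fset_of_surj (fun a => hF X a XF).
  by exists Z; rewrite //= inE EZ.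
rewrite card_imfset /= -?cardE; last exact: fset_of_inj.
apply: eq_card => Z; rewrite !inE; apply/imfsetP/idP => [[Z' /=]|ZF].
  by rewrite inE => ? /fset_of_inj ->.
by exists Z; rewrite //= inE.
Qed.

(** A subset with one element fewer omits a single element of X, so distinct Y give distinct
    removable elements; 0 < r makes [r.-1] a true decrease. *)
Lemma admissible_adm r k N (A B : {fset {fset nat}}) : 0 < r -> admissible r k A B ->
  adm r k [set Z : {set 'I_N} | fset_of Z \in A] [set Z | fset_of Z \in B].
Proof.
move=> r0 [hA [hB hk]]; split=> Z; rewrite inE => ZF; last by rewrite -card_fset_of hB.
rewrite -card_fset_of hA //; split=> //.
have [s [<- us hs]] := hk _ ZF.
set D := removable _ _; rewrite cardE -(size_map (fun i => fset_of (Z :\ i))).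
apply: uniq_leq_size us _ => Y Ys; have [YB YZ] := hs _ Ys.
have : #|` fset_of Z `\` Y| == 1.
  by rewrite cardfsDS // hA // hB //; apply/eqP; lia.
case/cardfs1P=> a Ea.
have : a \in fset_of Z `\` Y by rewrite Ea inE.
rewrite inE => /andP[aY aZ]; case/imfsetP: (aZ) => i /= iZ Ei.
have EY : Y = fset_of (Z :\ i).
  rewrite fset_ofD1 (_ : val i = a) -?Ea; last by []; apply/fsetP=> b; rewrite !inE.
  case: (boolP (b \in Y)) => [/(fsubsetP YZ) ->//|_] /=.
  by rewrite andNb.
by apply/mapP; exists i; rewrite // mem_enum !inE iZ -EY.
Qed.

(** For k = 1 the cascade sum is empty, so b = 0, and no X can have a subset in [B]. *)
Lemma upper_bound k : 0 < k -> exists tau, forall r b, k <= r ->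
  (k = 1 -> b = 0) -> f_atmost r k b (casc k.-1 b + tau).
Proof.
move=> k0; have [->|k1] : k = 1 \/ 1 < k by lia.
  exists 0 => r b _ /(_ erefl) -> A B [_ [_ hk]] /eqP.
  rewrite cardfs_eq0 => /eqP B0; rewrite leqn0 cardfs_eq0.
  apply/eqP/fsetP=> X; rewrite inE; apply/negP=> /hk[[|Y s] [] //] _ _ /(_ Y).
  by rewrite B0 !inE eqxx => /(_ isT)[].
have [tau h] := adm_upper k1; exists tau => r b kr _ A B adA <-.
have [N hN] := fsets_bounded (A `|` B).
have := h _ _ _ _ (admissible_adm N (leq_trans k0 kr) adA).
by rewrite !card_preim_fset_of // => X a XF; apply: hN; rewrite inE XF ?orbT.
Qed.

Lemma lower_bound r k b : 0 < k -> k <= r -> (k = 1 -> b = 0) ->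
  f_atleast r k b (casc k.-1 b).
Proof.
case: k => // j _ kr hb /=.
have [c hc] : exists c, b <= 'C(c, j).
  case: j hb {kr} => [|j] hb; first by exists 0; rewrite hb.
  by have /andP[_ /ltnW h] := casc_topP j b; exists (casc_top j.+1 b).+1.
have [A [B [cB cA hB hA]]] := casc_family (ltnSn c) hc.
set N := c.+1 in A B cB cA hB hA.
(* These r-k common new points turn k-sets into r-sets and preserve inclusions. *)
pose S := [fset i | i in iota N (r - j.+1)].
have inS a : (a \in S) = (N <= a < N + (r - j.+1)) by rewrite !inE mem_iota.
pose emb (Z : {set 'I_N}) := fset_of Z `|` S.
have emb_inj : injective emb.
  move=> Z1 Z2 /fsetP E; apply/setP=> i; move: (E (val i)).
  by rewrite !in_fsetU !inS leqNgt ltn_ord !orbF !in_fset_of.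
have card_emb Z : #|` emb Z| = (#|Z| + (r - j.+1))%N.
  rewrite cardfsU card_fset_of.
  have -> : fset_of Z `&` S = fset0.
    apply/fsetP=> a; rewrite in_fsetI inS inE; apply/negP=> /andP[/fset_of_lt]; lia.
  by rewrite cardfs0 subn0 card_fseq undup_id ?iota_uniq // size_iota.
have card_fam (F : {set {set 'I_N}}) : #|` [fset emb Z | Z in F]| = #|F|.
  by rewrite card_imfset /= ?cardE.
exists [fset emb Z | Z in A], [fset emb Z | Z in B].
rewrite !card_fam cB cA; split=> //; split; last split.
- by move=> _ /imfsetP[X /= XA ->]; have [_ cX _] := hA _ XA; rewrite card_emb cX; lia.
- by move=> _ /imfsetP[Y /= YB ->]; have [_ cY] := hB _ YB; rewrite card_emb cY; lia.
move=> _ /imfsetP[X /= XA ->]; have [_ cX hX] := hA _ XA.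
exists [seq emb (X :\ x) | x <- enum X]; split.
- by rewrite size_map -cardE.
- rewrite map_inj_in_uniq ?enum_uniq // => x y; rewrite !mem_enum => xX yX /emb_inj.
  by move/setP/(_ x); rewrite !inE eqxx xX andbT /=; case: eqVneq.
move=> Y /mapP[x]; rewrite mem_enum => xX ->; split.
  by apply/imfsetP; exists (X :\ x); rewrite //= hX.
by rewrite /emb fset_ofD1 fsetSU // fsubD1set.
Qed.

Local Close Scope fset_scope.

Theorem theorem3 :
  forall k : nat, 1 <= k ->
  exists tau : nat,
  forall (r b : nat) (c : nat -> nat),
    k <= r ->
    (forall i, 1 <= i -> i.+1 < k -> c i < c i.+1) ->
    b = \sum_(1 <= i < k) 'C(c i, i) ->
    f_atleast r k b (\sum_(1 <= i < k) 'C(c i, i.+1)) /\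
    f_atmost r k b (\sum_(1 <= i < k) 'C(c i, i.+1) + tau).
Proof.
move=> k k0; have [tau h] := upper_bound k0; exists tau => r b c kr hc Eb.
have Ec : casc k.-1 b = \sum_(1 <= i < k) 'C(c i, i.+1).
  case: k k0 hc Eb {h kr} => // j _ hc ->; exact: casc_cascade.
have b0 : k = 1 -> b = 0 by move=> k1; rewrite Eb k1 big_geq.
by rewrite -Ec; split; [exact: lower_bound | exact: h].
Qed.
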